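(* The permutohedron $\mathsf{P}(4)$ does not satisfy the lattice identity $(\mathrm{Veg}_1)$. In particular, there is no lattice embedding of $\mathsf{P}(4)$ into any Tamari lattice $\mathsf{A}(\ell)$ ($\ell$ a positive integer).
   Context: Notation: $[n]=\{1,\dots,n\}$ and $\mathcal{I}_n=\{(i,j)\in[n]\times[n] : i<j\}$. Permutohedra: a subset $\boldsymbol{x}\subseteq\mathcal{I}_n$ is closed if it is transitive as a binary relation, and clopen if both $\boldsymbol{x}$ and $\mathcal{I}_n\setminus\boldsymbol{x}$ are closed. The permutohedron $\mathsf{P}(n)$ is the set of all clopen subsets of $\mathcal{I}_n$, ordered by inclusion; it is a lattice. Tamari lattices: $\mathsf{A}(n)$ is the set of all transitive subsets $\boldsymbol{a}\subseteq\mathcal{I}_n$ such that $1\le i<j<k\le n$ and $(i,k)\in\boldsymbol{a}$ imply $(i,j)\in\boldsymbol{a}$, ordered by inclusion; it is a lattice. A lattice embedding is an injective map preserving binary meets and joins. A lattice satisfies an identity if it holds for every assignment of elements of the lattice to the variables. The identity $(\mathrm{Veg}_1)$, in the variables $\mathsf a_1,\mathsf a_2,\mathsf b_1,\mathsf b_2$, is $$(\mathsf a_1\vee\mathsf b_1)\wedge(\mathsf a_2\vee\mathsf b_2)\le\bigl((\mathsf a_1\vee\mathsf b_1)\wedge(\mathsf a_1\vee\tilde{\mathsf b}_2)\bigr)\vee\bigl((\mathsf a_2\vee\tilde{\mathsf b}_1)\wedge(\mathsf a_2\vee\mathsf b_2)\bigr),$$ where $\tilde{\mathsf b}_i=(\mathsf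 b_1\vee\mathsf b_2)\wedge(\mathsf a_i\vee\mathsf b_i)$ for $i\in\{1,2\}$. *)

(* Defs.v *)
From HB Require Import structures.
From mathcomp Require Import all_boot all_order.

Set Implicit Arguments.
Unset Strict Implicit.
Unset Printing Implicit Defensive.

Import Order.TTheory.

Section IncreasingPairs.
Variable n : nat.
Implicit Types x y u v a : {set 'I_n * 'I_n}.

(* [n] = {1, ..., n} is represented by 'I_n = {0, ..., n - 1}; only the order
   of the elements matters below. *)
Definition incpairs : {set 'I_n * 'I_n} := [set p : 'I_n * 'I_n | p.1 < p.2].

Definition trans_set x : bool :=
  [forall i : 'I_n, forall j : 'I_n, forall k : 'I_n,
    ((i, j) \in x) && ((j, k) \in x) ==> ((i, k) \in x)].

Definition clopen x : bool :=
  [&& x \subset incpairs, trans_set x & trans_set (incpairs :\: x)].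

Definition tamari_set a : bool :=
  [&& a \subset incpairs, trans_set a &
    [forall i : 'I_n, forall j : 'I_n, forall k : 'I_n,
      [&& i < j, j < k & (i, k) \in a] ==> ((i, j) \in a)]].

Lemma trans_setP x :
  reflect (transitive (fun i j : 'I_n => (i, j) \in x)) (trans_set x).
Proof.
apply: (iffP idP) => [H j i k ij jk|H].
  by have /forallP/(_ i)/forallP/(_ j)/forallP/(_ k) := H; rewrite ij jk.
apply/forallP=> i; apply/forallP=> j; apply/forallP=> k; apply/implyP.
by case/andP; apply: H.
Qed.

Lemma clopenP x :
  reflect [/\ x \subset incpairs, trans_set x & trans_set (incpairs :\: x)]
          (clopen x).
Proof. exact: and3P. Qed.

Lemma tamari_setP a :
  reflect [/\ a \subset incpairs, trans_set a &
              forall i j k : 'I_n, i < j -> j < k -> (i, k) \in a -> (i, j) \in a]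
          (tamari_set a).
Proof.
apply: (iffP and3P) => -[sa ta H]; split=> //.
  move=> i j k ij jk ik.
  by have /forallP/(_ i)/forallP/(_ j)/forallP/(_ k) := H; rewrite ij jk ik.
apply/forallP=> i; apply/forallP=> j; apply/forallP=> k; apply/implyP.
by case/and3P; apply: H.
Qed.

Lemma incpairs_trans : trans_set incpairs.
Proof. by apply/trans_setP=> j i k; rewrite !inE; apply: ltn_trans. Qed.

Definition tclosure u : {set 'I_n * 'I_n} :=
  [set p in incpairs | connect (fun i j : 'I_n => (i, j) \in u) p.1 p.2].

Lemma tclosure_trans u : trans_set (tclosure u).
Proof.
apply/trans_setP=> j i k; rewrite !inE /= => /andP[ij cij] /andP[jk cjk].
by rewrite (ltn_trans ij jk) (connect_trans cij cjk).
Qed.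

Lemma sub_tclosure u : u \subset incpairs -> u \subset tclosure u.
Proof.
move=> su; apply/subsetP=> -[i j] uij; rewrite !inE /= connect1 // andbT.
by have := subsetP su _ uij; rewrite inE.
Qed.

Lemma connect_trans_set u i j :
  trans_set u -> connect (fun i j : 'I_n => (i, j) \in u) i j ->
  i != j -> (i, j) \in u.
Proof.
move=> /trans_setP tu /connectP[p]; elim: p i => [|k p IH] i /=.
  by move=> _ ->; rewrite eqxx.
case/andP=> ik pp jl _; case: (eqVneq k j) => [<- //|kj].
exact: tu ik (IH k pp jl kj).
Qed.

Lemma tclosure_min u v : u \subset v -> trans_set v -> tclosure u \subset v.
Proof.
move=> uv tv; apply/subsetP=> -[i j]; rewrite !inE /= => /andP[ij cij].
apply: connect_trans_set => //; last by rewrite -val_eqE /= ltn_eqF.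
by apply: connect_sub cij => a b uab; apply/connect1/(subsetP uv).
Qed.

Lemma tclosure_open u : u \subset incpairs ->
  trans_set (incpairs :\: u) -> trans_set (incpairs :\: tclosure u).
Proof.
move=> su tu.
have lt_u (a b : 'I_n) : (a, b) \in u -> a < b.
  by move=> /(subsetP su); rewrite inE.
have split_u (a b c : 'I_n) : (a, c) \in u -> a < b -> b < c ->
    ((a, b) \in u) || ((b, c) \in u).
  move=> ac ab bc; apply/negPn/negP; rewrite negb_or => /andP[nab nbc].
  have := trans_setP _ tu b a c.
  by rewrite /= !inE nab nbc ab bc ac /= => /(_ isT isT).
suff main (i j k : 'I_n) : connect (fun i j : 'I_n => (i, j) \in u) i k -> i < j -> j < k ->
    connect (fun i j : 'I_n => (i, j) \in u) i j
    || connect (fun i j : 'I_n => (i, j) \in u) j k.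
  apply/trans_setP=> j i k; rewrite !inE => /andP[nij /= ij] /andP[njk /= jk].
  move: nij njk; rewrite ij jk (ltn_trans ij jk) /= andbT => nij njk.
  apply/negP=> ik; have := main i j k ik ij jk.
  by rewrite (negbTE nij) (negbTE njk).
case/connectP=> p; elim: p i => [|z p IH] i /=.
  by move=> _ -> ij /(ltn_trans ij); rewrite ltnn.
case/andP=> iz pp kl ij jk.
have czk : connect (fun i j : 'I_n => (i, j) \in u) z k by apply/connectP; exists p.
case: (ltngtP z j) => [zj|jz|/val_inj zj].
- case/orP: (IH z pp kl zj jk) => [c|->]; last by rewrite orbT.
  by rewrite (connect_trans (connect1 iz) c).
- case/orP: (split_u i j z iz ij jz) => [c|c]; first by rewrite connect1.
  by rewrite (connect_trans (connect1 c) czk) orbT.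
- by rewrite -zj connect1.
Qed.

Lemma trans_setI x y : trans_set x -> trans_set y -> trans_set (x :&: y).
Proof.
move=> /trans_setP tx /trans_setP ty; apply/trans_setP=> j i k.
by rewrite !inE => /andP[? ?] /andP[? ?]; rewrite (tx j) // (ty j).
Qed.

Lemma incpairsDK x : x \subset incpairs -> incpairs :\: (incpairs :\: x) = x.
Proof. by move=> sx; rewrite setDDr setDv set0U; apply/setIidPr. Qed.

Lemma clopenC x : clopen x -> clopen (incpairs :\: x).
Proof.
case/clopenP=> sx tx tcx; apply/clopenP.
by rewrite incpairsDK // subsetDl.
Qed.

Lemma clopen_join x y : clopen x -> clopen y -> clopen (tclosure (x :|: y)).
Proof.
move=> /clopenP[sx tx tcx] /clopenP[sy ty tcy]; apply/clopenP; split.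
- by apply/subsetP=> p; rewrite !inE => /andP[].
- exact: tclosure_trans.
- apply: tclosure_open; first by rewrite subUset sx.
  by rewrite setDUr trans_setI.
Qed.

Definition clopen_meet x y : {set 'I_n * 'I_n} :=
  incpairs :\: tclosure ((incpairs :\: x) :|: (incpairs :\: y)).

Lemma clopen_meetP x y : clopen x -> clopen y -> clopen (clopen_meet x y).
Proof. by move=> cx cy; apply/clopenC/clopen_join; apply: clopenC. Qed.

Lemma tclosureU_sub x y z : clopen x -> clopen y -> clopen z ->
  (tclosure (x :|: y) \subset z) = (x \subset z) && (y \subset z).
Proof.
move=> /clopenP[sx _ _] /clopenP[sy _ _] /clopenP[_ tz _].
rewrite -subUset; apply/idP/idP => [|H]; last exact: tclosure_min.
by apply: subset_trans; apply: sub_tclosure; rewrite subUset sx.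
Qed.

Lemma sub_clopen_meet x y z : clopen x -> clopen y -> clopen z ->
  (x \subset clopen_meet y z) = (x \subset y) && (x \subset z).
Proof.
move=> cx cy cz.
have subC a b : clopen a -> clopen b ->
    (incpairs :\: b \subset incpairs :\: a) = (a \subset b).
  move=> /clopenP[sa _ _] /clopenP[sb _ _].
  apply/idP/idP => [/(setDS incpairs)|H]; last exact: setDS.
  by rewrite !incpairsDK.
rewrite -subC ?clopen_meetP // /clopen_meet incpairsDK; last first.
  by apply/subsetP=> p; rewrite !inE => /andP[].
by rewrite tclosureU_sub ?clopenC // !subC.
Qed.

Lemma incpairs_tamari : tamari_set incpairs.
Proof.
apply/tamari_setP; split=> [//||i j k ij _ _]; first exact: incpairs_trans.
by rewrite inE.
Qed.

Lemma tamari_setI a b : tamari_set a -> tamari_set b -> tamari_set (a :&: b).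
Proof.
move=> /tamari_setP[sa ta da] /tamari_setP[sb tb db]; apply/tamari_setP.
split; [exact: subset_trans (subsetIl _ _) sa|exact: trans_setI|].
by move=> i j k ij jk; rewrite !inE => /andP[/(da _ _ _ ij jk)-> /(db _ _ _ ij jk)].
Qed.

Definition tamari_join a b : {set 'I_n * 'I_n} :=
  incpairs :&: \bigcap_(c | tamari_set c && (a :|: b \subset c)) c.

Lemma tamari_joinP a b : tamari_set (tamari_join a b).
Proof.
rewrite /tamari_join; elim/big_rec: _ => [|c d /andP[tc _] td].
  by rewrite setIT incpairs_tamari.
by rewrite setICA tamari_setI.
Qed.

Lemma tamari_join_sub a b c : tamari_set a -> tamari_set b -> tamari_set c ->
  (tamari_join a b \subset c) = (a \subset c) && (b \subset c).
Proof.
move=> /tamari_setP[sa _ _] /tamari_setP[sb _ _] tc; rewrite -subUset.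
apply/idP/idP => [|H].
  apply: subset_trans; rewrite subsetI subUset sa sb /=.
  by apply/bigcapsP=> d /andP[].
by apply/(subset_trans (subsetIr _ _))/bigcap_inf; rewrite tc H.
Qed.

End IncreasingPairs.

Record permutohedron n := Permutohedron {
  perm_set :> {set 'I_n * 'I_n};
  perm_set_clopen : clopen perm_set }.

HB.instance Definition _ n := [isSub for @perm_set n].
HB.instance Definition _ n := [Finite of permutohedron n by <:].

Record tamari n := Tamari {
  tam_set :> {set 'I_n * 'I_n};
  tam_set_tamari : tamari_set tam_set }.

HB.instance Definition _ n := [isSub for @tam_set n].
HB.instance Definition _ n := [Finite of tamari n by <:].

Fact permutohedron_display : Order.disp_t.
Proof. exact: (Order.Disp tt tt). Qed.

Fact tamari_display : Order.disp_t.
Proof. exact: (Order.Disp tt tt). Qed.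

Section PermutohedronLattice.
Variable n : nat.
Implicit Types x y z : permutohedron n.

Definition perm_le x y : bool := perm_set x \subset perm_set y.

Fact perm_le_refl : reflexive perm_le.
Proof. by move=> x; apply: subxx. Qed.

Fact perm_le_anti : antisymmetric perm_le.
Proof. by move=> x y; rewrite -eqEsubset => /eqP/val_inj. Qed.

Fact perm_le_trans : transitive perm_le.
Proof. by move=> y x z; apply: subset_trans. Qed.

HB.instance Definition _ :=
  Order.Le_isPOrder.Build permutohedron_display (permutohedron n)
    perm_le_refl perm_le_anti perm_le_trans.

Definition perm_meet x y : permutohedron n :=
  Permutohedron (clopen_meetP (perm_set_clopen x) (perm_set_clopen y)).

Definition perm_join x y : permutohedron n :=
  Permutohedron (clopen_join (perm_set_clopen x) (perm_set_clopen y)).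

Fact perm_meetP x y z :
  (x <= perm_meet y z)%O = (x <= y)%O && (x <= z)%O.
Proof. by apply: sub_clopen_meet; apply: perm_set_clopen. Qed.

Fact perm_joinP x y z :
  (perm_join x y <= z)%O = (x <= z)%O && (y <= z)%O.
Proof. by apply: tclosureU_sub; apply: perm_set_clopen. Qed.

HB.instance Definition _ :=
  Order.POrder_MeetJoin_isLattice.Build permutohedron_display (permutohedron n)
    perm_meetP perm_joinP.

End PermutohedronLattice.

Section TamariLattice.
Variable n : nat.
Implicit Types a b c : tamari n.

Definition tam_le a b : bool := tam_set a \subset tam_set b.

Fact tam_le_refl : reflexive tam_le.
Proof. by move=> a; apply: subxx. Qed.

Fact tam_le_anti : antisymmetric tam_le.
Proof. by move=> a b; rewrite -eqEsubset => /eqP/val_inj. Qed.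

Fact tam_le_trans : transitive tam_le.
Proof. by move=> b a c; apply: subset_trans. Qed.

HB.instance Definition _ :=
  Order.Le_isPOrder.Build tamari_display (tamari n)
    tam_le_refl tam_le_anti tam_le_trans.

Definition tam_meet a b : tamari n :=
  Tamari (tamari_setI (tam_set_tamari a) (tam_set_tamari b)).

Definition tam_join a b : tamari n := Tamari (tamari_joinP a b).

Fact tam_meetP a b c : (a <= tam_meet b c)%O = (a <= b)%O && (a <= c)%O.
Proof. exact: subsetI. Qed.

Fact tam_joinP a b c : (tam_join a b <= c)%O = (a <= c)%O && (b <= c)%O.
Proof. by apply: tamari_join_sub; apply: tam_set_tamari. Qed.

HB.instance Definition _ :=
  Order.POrder_MeetJoin_isLattice.Build tamari_display (tamari n)
    tam_meetP tam_joinP.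

End TamariLattice.

Section LatticeNotions.
Local Open Scope order_scope.

Definition lattice_embedding d (L : latticeType d) d' (K : latticeType d')
    (f : L -> K) : Prop :=
  [/\ injective f,
      {morph f : x y / x `&` y} &
      {morph f : x y / x `|` y}].

Definition satisfies_Veg1 d (L : latticeType d) : Prop :=
  forall a1 a2 b1 b2 : L,
  let bt1 := (b1 `|` b2) `&` (a1 `|` b1) in
  let bt2 := (b1 `|` b2) `&` (a2 `|` b2) in
  (a1 `|` b1) `&` (a2 `|` b2) <=
    ((a1 `|` b1) `&` (a1 `|` bt2)) `|` ((a2 `|` bt1) `&` (a2 `|` b2)).

End LatticeNotions.

(* Main.v *)
Require Import Defs.
From mathcomp Require Import all_boot all_order.

(** In A(l), where the join is the transitive closure of the union, suppose
    (i, j) lies in A1 = a1 \/ b1 and in A2 = a2 \/ b2, and that every (i, t)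
    with t < j is already known to lie in the right-hand side r.  The path
    witnessing (i, j) \in A1 ends with a step (w, j), which may be assumed to be
    in b1.  The path witnessing (i, j) \in A2 has a step jumping over w from some
    v <= w, so (v, w) \in a2 or (v, w) \in b2 (or v = w).  If v = w, or if the
    step is in a2, then (v, j) \in r; if it is in b2, then (v, j) lies again in
    b1 \/ b2, and one repeats the argument with v < w and the path in A1.  The
    descent ends at the latest at i.

    In P(4), numbered from 0, the elements a1 = {02, 12}, a2 = {12, 13},
    b1 = {23}, b2 = {01} give a left-hand side above {02, 03, 12, 13} and a
    right-hand side below {02, 12, 13}. *)

Set Implicit Arguments.
Unset Strict Implicit.
Unset Printing Implicit Defensive.

Import Order.TTheory.

(** * Transfer of the identity along lattice embeddings *)

Section Embedding.
Local Open Scope order_scope.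

Lemma embedding_Veg1 d (L : latticeType d) d' (K : latticeType d') (f : L -> K) :
  lattice_embedding f -> satisfies_Veg1 K -> satisfies_Veg1 L.
Proof.
case=> f_inj fI fU vegK a1 a2 b1 b2 /=.
have := vegK (f a1) (f a2) (f b1) (f b2).
(* An inequality is an equation between a meet and one of its arguments, so the injectivity of [f]
   reflects it. *)
by rewrite /= -!(fU, fI) !leEmeet -fI => /eqP/f_inj->.
Qed.

End Embedding.

(** * Joins in Tamari lattices through increasing paths *)

Section TamariJoin.
Variable n : nat.
Implicit Types a b : tamari n.

Lemma tam_lt a (i j : 'I_n) : (i, j) \in tam_set a -> i < j.
Proof.
by case: a => a /= /tamari_setP[/subsetP sa _ _] /sa; rewrite inE.
Qed.

Lemma tam_trans a : transitive (fun i j : 'I_n => (i, j) \in tam_set a).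
Proof. by case: a => a /= /tamari_setP[_ /trans_setP]. Qed.

Lemma tam_prefix a (i j k : 'I_n) :
  i < j -> j <= k -> (i, k) \in tam_set a -> (i, j) \in tam_set a.
Proof.
move=> ij; rewrite leq_eqVlt => /predU1P[/val_inj->//|jk].
by case: a => a /= /tamari_setP[_ _ /(_ _ _ _ ij jk)].
Qed.

Lemma in_tamI a b p :
  (p \in tam_set (a `&` b)%O) = (p \in tam_set a) && (p \in tam_set b).
Proof. exact: in_setI. Qed.

Lemma in_tamUl a b p : p \in tam_set a -> p \in tam_set (a `|` b)%O.
Proof. exact/subsetP/(leUl a b). Qed.

Lemma in_tamUr a b p : p \in tam_set b -> p \in tam_set (a `|` b)%O.
Proof. exact/subsetP/(leUr b a). Qed.

Let edge a b : rel 'I_n :=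
  fun i j => ((i, j) \in tam_set a) || ((i, j) \in tam_set b).

(** A path from [i] to [k] has a first step reaching [j] or beyond. Cut at [j], this step stays in
    its set, which leaves a path from [i] to [j]. *)
Lemma tamari_tclosure a b : tamari_set (tclosure (tam_set a :|: tam_set b)).
Proof.
have edgeE (i j : 'I_n) : ((i, j) \in tam_set a :|: tam_set b) = edge a b i j.
  by rewrite inE.
apply/tamari_setP; split; first by apply/subsetP=> p; rewrite !inE => /andP[].
  exact: tclosure_trans.
move=> i j k ij jk; rewrite !inE /= ij => /andP[_].
rewrite !(eq_connect edgeE) => /connectP[p].
elim: p i ij => [|z p IH] i ij /=.
  by move=> _ ki; move: (ltn_trans ij jk); rewrite ki ltnn.
case/andP=> iz pp kE; case: (ltnP z j) => [zj|jz].
  exact: connect_trans (connect1 iz) (IH z zj pp kE).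
by apply: connect1; case/orP: iz => /(tam_prefix ij jz) iz; rewrite /edge iz ?orbT.
Qed.

(** The join is built as an intersection of Tamari sets; the transitive closure of the union is one
    of them, so the two coincide. *)
Lemma in_tamU_connect a b (i j : 'I_n) :
  ((i, j) \in tam_set (a `|` b)%O) = (i < j) && connect (edge a b) i j.
Proof.
have edgeE (k l : 'I_n) : ((k, l) \in tam_set a :|: tam_set b) = edge a b k l.
  by rewrite inE.
rewrite -(eq_connect edgeE); transitivity ((i, j) \in tclosure (tam_set a :|: tam_set b)); last first.
  by rewrite !inE.
have [sa _ _] := tamari_setP _ (tam_set_tamari a).
have [sb _ _] := tamari_setP _ (tam_set_tamari b).
have subcl := sub_tclosure (introT subUsetP (conj sa sb)).
apply/idP/idP; apply/subsetP.
  by rewrite tamari_join_sub ?tam_set_tamari ?tamari_tclosure // -subUset.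
apply: tclosure_min; last
  by have [] := tamari_setP _ (tamari_joinP (tam_set a) (tam_set b)).
by rewrite subUset (leUl a b : _ \subset _) (leUr b a : _ \subset _).
Qed.

(** The step found is the first one of the path that ends beyond [w]. Taking [w] in [nat] allows the
    value [j.-1]. *)
Lemma tamU_step a b (i j : 'I_n) (w : nat) :
    (i, j) \in tam_set (a `|` b)%O -> i <= w < j ->
  exists v v' : 'I_n, [/\ i <= v <= w, w < v' <= j,
    (v, v') \in tam_set a \/ (v, v') \in tam_set b &
    (v, j) \in tam_set (a `|` b)%O].
Proof.
rewrite in_tamU_connect => /andP[_ /connectP[p]].
elim: p i => [|z p IH] i /=; first by move=> _ ->; rewrite ltnNge andbN.
case/andP=> iz pp jE /andP[iw wj].
have zj : connect (edge a b) z j by apply/connectP; exists p.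
have iz_lt : i < z by case/orP: iz => /tam_lt.
case: (ltnP w z) => [wz|zw].
  exists i, z; split; rewrite ?leqnn ?wz //=; last first.
  - by rewrite in_tamU_connect (leq_ltn_trans iw wj) (connect_trans (connect1 iz) zj).
  - exact/orP.
  (* The rest of the path increases from [z] to [j], hence [z <= j]. *)
  elim: p {IH} z pp jE {iz zj iz_lt wz} => [|y p IH] z /=; first by move=> _ ->.
  case/andP=> zy pp jE; apply: leq_trans (IH y pp jE).
  by case/orP: zy => /tam_lt/ltnW.
have [|v [v' [/andP[zv vw] vj' st vj]]] := IH z pp jE; first by rewrite zw.
by exists v, v'; rewrite vw (leq_trans (ltnW iz_lt) zv).
Qed.

End TamariJoin.

(** * The identity in Tamari lattices *)

Section TamariVeg1.
Variable n : nat.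

Section Descent.
Variables (r : tamari n) (i j : 'I_n).
Hypothesis r_before : forall t : 'I_n, i < t < j -> (i, t) \in tam_set r.

Lemma in_r_from (v : 'I_n) : i <= v -> (v, j) \in tam_set r -> (i, j) \in tam_set r.
Proof.
rewrite leq_eqVlt => /predU1P[/val_inj->//|iv] vj.
by apply: tam_trans (vj); apply: r_before; rewrite iv (tam_lt vj).
Qed.

(** The indices 1 and 2 exchange roles at each recursive call, so the hypotheses on [r] are
    symmetric in them; [m] bounds the decreasing [w]. *)
Lemma descent (m : nat) (a1 a2 b1 b2 : tamari n) (w : 'I_n)
    (B := (b1 `|` b2)%O) (A1 := (a1 `|` b1)%O) (A2 := (a2 `|` b2)%O) :
    (A1 `&` (a1 `|` (B `&` A2)) <= r)%O -> (A2 `&` (a2 `|` (B `&` A1)) <= r)%O ->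
    (i, j) \in tam_set A1 -> (i, j) \in tam_set A2 ->
    w < m -> i <= w -> (w, j) \in tam_set B -> (w, j) \in tam_set A1 ->
  (i, j) \in tam_set r.
Proof.
elim: m a1 a2 b1 b2 w @B @A1 @A2 => // m IH a1 a2 b1 b2 w B A1 A2.
move=> r1 r2 ij1 ij2 wm iw wjB wj1.
have [|v [v' [/andP[iv vw] /andP[wv' v'j] st vj]]] := tamU_step ij2 (w := w).
  by rewrite iw (tam_lt wj1).
have [eq_vw|lt_vw] := eqVneq v w.
  apply: (in_r_from iw); apply: (subsetP r1).
  by rewrite in_tamI wj1 in_tamUr // in_tamI wjB -eq_vw.
have {}lt_vw : v < w by rewrite ltn_neqAle vw andbT.
case: st => /(tam_prefix lt_vw (ltnW wv')) vwst.
  apply: (in_r_from iv); apply: (subsetP r2); rewrite in_tamI vj.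
  by apply: tam_trans (in_tamUl _ vwst) (in_tamUr _ _); rewrite in_tamI wjB.
apply: (IH a2 a1 b2 b1 v) => //; rewrite 1?[(b2 `|` b1)%O]joinC //.
  exact: leq_trans lt_vw wm.
by apply: tam_trans (in_tamUr _ vwst) wjB.
Qed.

End Descent.

Theorem tamari_Veg1 : satisfies_Veg1 (tamari n).
Proof.
move=> a1 a2 b1 b2 /=; set bt1 := ((b1 `|` b2) `&` (a1 `|` b1))%O.
set bt2 := ((b1 `|` b2) `&` (a2 `|` b2))%O; set r := (X in (_ <= X)%O).
have r1 : ((a1 `|` b1) `&` (a1 `|` bt2) <= r)%O by exact: leUl.
have r2 : ((a2 `|` b2) `&` (a2 `|` bt1) <= r)%O by rewrite meetC leUr.
apply/subsetP=> -[i j]; have [m] := ubnP (val j); elim: m j => // m IH j jm.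
rewrite in_tamI => /andP[ij1 ij2]; have ij := tam_lt ij1.
have r_before (t : 'I_n) : i < t < j -> (i, t) \in tam_set r.
  case/andP=> it tj; apply: IH; first exact: leq_trans tj jm.
  by rewrite in_tamI !(tam_prefix it (ltnW tj)).
(* A step over [j.-1] that does not pass [j] must end at [j]. *)
have [|w [w' [/andP[iw _] jw' st wj]]] := tamU_step ij1 (w := j.-1).
  by case: (val j) ij => //= k; rewrite ltnS leqnn andbT.
have {jw'}jE : w' = j.
  apply/val_inj/eqP; move: jw'.
  by rewrite eqn_leq prednK ?(leq_ltn_trans _ ij) // andbC.
case: st; rewrite jE => wjst; last first.
  apply: (descent r_before r1 r2 ij1 ij2 (ltnSn w)) => //.
  exact: in_tamUl.
(* A last step in [a1] lies in both factors of the first meet. *)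
apply: (in_r_from r_before iw); apply: (subsetP r1).
by rewrite in_tamI wj in_tamUl.
Qed.

End TamariVeg1.

(** * Clopen sets given by lists and checked by computation *)

Section ExplicitClopens.
Variable n : nat.
Implicit Types s : seq (nat * nat).

Definition pair_set s : {set 'I_n * 'I_n} :=
  [set p : 'I_n * 'I_n | (val p.1, val p.2) \in s].

(** Transitivity of the complement is tested contrapositively, so that only listed pairs have to be
    split. *)
Definition clopen_test s : bool :=
  [&& all (fun p => p.1 < p.2) s,
      all (fun p => all (fun q => (p.2 == q.1) ==> ((p.1, q.2) \in s)) s) s &
      all (fun p => all (fun j => (p.1 < j < p.2) ==>
                           ((p.1, j) \in s) || ((j, p.2) \in s)) (iota 0 n)) s].

Lemma clopen_pair_set s : clopen_test s -> clopen (pair_set s).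
Proof.
case/and3P=> /allP s_lt /allP s_tr /allP s_op; apply/clopenP; split.
- by apply/subsetP=> p; rewrite !inE => /s_lt.
- apply/trans_setP=> j i k; rewrite !inE => ij jk.
  by have /allP/(_ _ jk) := s_tr _ ij; rewrite eqxx.
- apply/trans_setP=> j i k; rewrite !inE /= => /andP[/negP nij ij] /andP[/negP njk jk].
  rewrite (ltn_trans ij jk) andbT; apply/negP=> ik.
  have /allP/(_ (val j)) := s_op _ ik.
  by rewrite mem_iota ltn_ord /= ij jk => /(_ isT)/orP[].
Qed.

Definition perm_of s (cs : clopen_test s) : permutohedron n :=
  Permutohedron (clopen_pair_set cs).

Lemma perm_of_le s t (cs : clopen_test s) (ct : clopen_test t) :
  {subset s <= t} -> (perm_of cs <= perm_of ct)%O.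
Proof. by move=> st; apply/subsetP=> p; rewrite !inE => /st. Qed.

Lemma perm_of_meet_le s t u (cs : clopen_test s) (ct : clopen_test t)
    (cu : clopen_test u) :
  all (fun p => (p \in t) ==> (p \in u)) s ->
  (perm_of cs `&` perm_of ct <= perm_of cu)%O.
Proof.
move=> /allP stu; apply/subsetP=> p px.
have := subsetP (leIl (perm_of cs) (perm_of ct) : _ \subset _) _ px.
have := subsetP (leIr (perm_of ct) (perm_of cs) : _ \subset _) _ px.
by rewrite !inE => pt /stu; rewrite pt.
Qed.

(** Paths of at most two steps are enough for the lower bound [low]. *)
Lemma perm_of_le_join s t u (cs : clopen_test s) (ct : clopen_test t)
    (cu : clopen_test u) :
  all (fun p => (p \in s ++ t) ||
    has (fun k => ((p.1, k) \in s ++ t) && ((k, p.2) \in s ++ t)) (iota 0 n)) u ->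
  (perm_of cu <= perm_of cs `|` perm_of ct)%O.
Proof.
move=> /allP ust; apply/subsetP=> -[i j]; rewrite inE => /ust /=.
have stP (k l : 'I_n) : (val k, val l) \in s ++ t ->
    (k, l) \in perm_set (perm_of cs `|` perm_of ct)%O.
  rewrite mem_cat => /orP[kl|kl].
    by apply: (subsetP (leUl (perm_of cs) (perm_of ct) : _ \subset _)); rewrite inE.
  by apply: (subsetP (leUr (perm_of ct) (perm_of cs) : _ \subset _)); rewrite inE.
case/orP=> [/stP//|/hasP[k]]; rewrite mem_iota /= add0n => k_lt /andP[ik kj].
have [_ /trans_setP tr _] := clopenP _ (perm_set_clopen (perm_of cs `|` perm_of ct)%O).
exact: tr (Ordinal k_lt) _ _ (stP i (Ordinal k_lt) ik) (stP (Ordinal k_lt) j kj).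
Qed.

End ExplicitClopens.

(** * The counterexample in P(4) *)

Theorem permutohedron4_not_Veg1 : ~ satisfies_Veg1 (permutohedron 4).
Proof.
pose P s (cs : clopen_test 4 s) := perm_of cs.
pose a1 := P [:: (0, 2); (1, 2)] isT.
pose a2 := P [:: (1, 2); (1, 3)] isT.
pose b1 := P [:: (2, 3)] isT.
pose b2 := P [:: (0, 1)] isT.
pose low := P [:: (0, 2); (0, 3); (1, 2); (1, 3)] isT.
pose high := P [:: (0, 2); (1, 2); (1, 3)] isT.
pose A1 := P [:: (0, 2); (0, 3); (1, 2); (1, 3); (2, 3)] isT.
pose A2 := P [:: (0, 1); (0, 2); (0, 3); (1, 2); (1, 3)] isT.
pose B := P [:: (0, 1); (2, 3)] isT.
have le_high : (((a1 `|` b1) `&` (a1 `|` ((b1 `|` b2) `&` (a2 `|` b2))))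
    `|` ((a2 `|` ((b1 `|` b2) `&` (a1 `|` b1))) `&` (a2 `|` b2)) <= high)%O.
  have leA1 : (a1 `|` b1 <= A1)%O by rewrite leUx !perm_of_le //; apply/allP.
  have leA2 : (a2 `|` b2 <= A2)%O by rewrite leUx !perm_of_le //; apply/allP.
  have leB : (b1 `|` b2 <= B)%O by rewrite leUx !perm_of_le //; apply/allP.
  have lebt1 : ((b1 `|` b2) `&` (a1 `|` b1) <= b1)%O.
    by apply: le_trans (leI2 leB leA1) _; apply: perm_of_meet_le.
  have lebt2 : ((b1 `|` b2) `&` (a2 `|` b2) <= b2)%O.
    by apply: le_trans (leI2 leB leA2) _; apply: perm_of_meet_le.
  (* [C1] and [C2] bound [a1 \/ b2] and [a2 \/ b1]; intersecting them with [A1] and [A2] leaves only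
     [a1] and [a2], both inside [high]. *)
  pose C1 := P [:: (0, 1); (0, 2); (1, 2)] isT.
  pose C2 := P [:: (1, 2); (1, 3); (2, 3)] isT.
  have leC1 : (a1 `|` b2 <= C1)%O by rewrite leUx !perm_of_le //; apply/allP.
  have leC2 : (a2 `|` b1 <= C2)%O by rewrite leUx !perm_of_le //; apply/allP.
  rewrite leUx; apply/andP; split.
    apply: le_trans (leI2 leA1 (le_trans (leU2 (lexx _) lebt2) leC1)) _.
    exact: perm_of_meet_le.
  apply: le_trans (leI2 (le_trans (leU2 (lexx _) lebt1) leC2) leA2) _.
  exact: perm_of_meet_le.
(* The pair (0, 3) arises as 0, 2, 3 in the first join and as 0, 1, 3 in the second. *)
have low_le : (low <= (a1 `|` b1) `&` (a2 `|` b2))%O.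
  by rewrite lexI !perm_of_le_join.
move=> /(_ a1 a2 b1 b2) /(le_trans low_le) /le_trans /(_ le_high).
move=> /subsetP/(_ (@Ordinal 4 0 isT, @Ordinal 4 3 isT)).
by rewrite !inE /= => /(_ isT).
Qed.

Theorem theorem8p2 :
  ~ satisfies_Veg1 (permutohedron 4) /\
  (forall l : nat, 0 < l ->
     ~ exists f : permutohedron 4 -> tamari l, lattice_embedding f).
Proof.
split=> [|l _ [f /embedding_Veg1 f_Veg1]]; first exact: permutohedron4_not_Veg1.
exact/permutohedron4_not_Veg1/f_Veg1/tamari_Veg1.
Qed.
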